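(* Let $n\ge 2$, let $G(V,E)$ be a directed graph on $V=\{1,\dots,n\}$ with positive weights $\alpha_{ij}$ ($ij\in E$), let $r_1,\dots,r_n>0$, $\tau>0$, and let $\kappa_1,\kappa_2,p\in\mathbb R$. Consider the linear recursion $z_{k+1}=Az_k$ defined in the context, with $z_k=[x(t_k)^T\,s(t_k)^T\,y(t_k)^T]^T\in\mathbb R^{3n}$ and $t_k=t_0+k\tau$. The following three statements are equivalent: 1. The graph $G(V,E)$ is connected, $\kappa_1\neq\kappa_2$, $0<p<2$, and $\rho(\hat J_2)<1$. 2. For every initial condition $z_0\in\mathbb R^{3n}$ there are constants $r^*,x^*\in\mathbb R$ such that, as $k\to\infty$, $\delta x(t_k)\to \mathbf 0_n$, $\delta s(t_k)\to\mathbf 0_n$, $\delta y(t_k)\to\mathbf 0_n$, and $\tilde x(t_k)-\big(r^*(t_k-t_0)+x^*\big)\to 0$, $\tilde s(t_k)\to r^*$, $\tilde y(t_k)\to 0$. 3. The system achieves synchronization: for every initial condition $z_0\in\mathbb R^{3n}$ there are constants $r^*,x^*\in\mathbb R$ such that $x_i(t_k)-\big(r^*(t_k-t_0)+x^*\big)\to 0$ as $k\to\infty$ for every $i\in V$. Moreover, whenever the system synchronizes, $$x^*=\gamma\sum_{i=1}^n\xi_i\Big(\frac{1}{r_i}x_i(t_0)+\tau\frac{\kappa_2}{p^2}\,y_i(t_0)\Big),\qquad r^*=\gamma\sum_{i=1}^n\xi_i\Big(s_i(t_0)-\frac{\kappa_2}{p}\,y_i(t_0)\Big).$$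
   Context: $G(V,E)$ is a directed graph without self-loops; $ij\in E$ means node $i$ measures its clock offset with respect to $j$, and $\mathcal N_i=\{j: ij\in E\}$. The graph is called connected if there is a node that every other node can reach by a directed path (equivalently, the Laplacian $L$ below has $0$ as a simple eigenvalue). The Laplacian $L\in\mathbb R^{n\times n}$ has $L_{ii}=\sum_{j\in\mathcal N_i}\alpha_{ij}$, $L_{ij}=-\alpha_{ij}$ if $ij\in E$, and $L_{ij}=0$ otherwise. $R=\mathrm{diag}(r_1,\dots,r_n)$. The recursion (the clock synchronization algorithm) is $$x_i(t_{k+1})=x_i(t_k)+\tau r_is_i(t_k),$$ $$s_i(t_{k+1})=s_i(t_k)+\kappa_1\sum_{j\in\mathcal N_i}\alpha_{ij}(x_j(t_k)-x_i(t_k))-\kappa_2y_i(t_k),$$ $$y_i(t_{k+1})=p\sum_{j\in\mathcal N_i}\alpha_{ij}(x_j(t_k)-x_i(t_k))+(1-p)y_i(t_k),$$ i.e. $z_{k+1}=Az_k$ with $$A=\begin{bmatrix} I_n&\tau R&0\\-\kappa_1L&I_n&-\kappa_2I_n\\-pL&0&(1-p)I_n\end{bmatrix}.$$ $\xi=[\xi_i]^T$ is a left eigenvector of $L$ for the eigenvalue $0$ with nonnegative entries and $\sum_i\xi_i=1$ (unique when $G$ is connected), and $\frac1\gamma=\sum_{i=1}^n\frac{\xi_i}{r_i}$. Define $$\tilde x(t_k)=\gamma\sum_i\frac{\xi_i}{r_i}x_i(t_k),\quad \tilde s(t_k)=\gamma\sum_i\xi_is_i(t_k),\quad \tilde y(t_k)=\gamma\sum_i\xi_iy_i(t_k),$$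 $$\delta x_i(t_k)=x_i(t_k)-\tilde x(t_k),\quad \delta s_i(t_k)=s_i(t_k)-\frac{\tilde s(t_k)}{r_i},\quad \delta y_i(t_k)=y_i(t_k)-\frac{\tilde y(t_k)}{r_i}.$$ When $G$ is connected, $\kappa_1\ne\kappa_2$ and $p>0$, the Jordan normal form of $A$ is $\mathrm{blockdiag}(\hat J_1,\hat J_2)$ with $$\hat J_1=\begin{bmatrix}1&1&0\\0&1&0\\0&0&1-p\end{bmatrix},$$ and $\hat J_2$ consists of the Jordan blocks of the remaining $3n-3$ eigenvalues of $A$ (counted with multiplicity, after removing $1,1,1-p$). $\rho(\cdot)$ denotes the spectral radius. *)

(* Defs.v *)
From mathcomp Require Import all_boot all_order all_algebra.
From mathcomp Require Import complex.
From mathcomp Require Import all_classical all_reals all_analysis.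

Set Implicit Arguments.
Unset Strict Implicit.
Unset Printing Implicit Defensive.

Import Order.TTheory GRing.Theory Num.Theory.
Import numFieldNormedType.Exports.

Local Open Scope classical_set_scope.
Local Open Scope ring_scope.

(** Connectedness is oriented: some node is reachable from every node along
    the edges, where the edge [E i j] means that [i] measures its offset with
    respect to [j]. *)
Definition connected_digraph (n : nat) (E : rel 'I_n) : Prop :=
  exists v : 'I_n, forall u : 'I_n, connect E u v.

Definition laplacian (R : realType) (n : nat) (E : rel 'I_n)
    (alpha : 'I_n -> 'I_n -> R) : 'M[R]_n :=
  \matrix_(i, j)
    if i == j then \sum_(k | E i k) alpha i k
    else if E i j then - alpha i j else 0.

Definition clock_mx (R : realType) (n : nat) (E : rel 'I_n)
    (alpha : 'I_n -> 'I_n -> R) (r : 'I_n -> R) (tau kappa1 kappa2 p : R) :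
    'M[R]_(n + (n + n)) :=
  let L := laplacian E alpha in
  block_mx 1%:M               (row_mx (tau *: diag_mx (\row_i r i)) 0)
           (col_mx (- kappa1 *: L)
                   (- p *: L)) (block_mx 1%:M (- kappa2%:M)
                                         0    (1 - p)%:M).

Definition clock_state (R : realType) (n : nat) (E : rel 'I_n)
    (alpha : 'I_n -> 'I_n -> R) (r : 'I_n -> R) (tau kappa1 kappa2 p : R)
    (z0 : 'cV[R]_(n + (n + n))) (k : nat) : 'cV[R]_(n + (n + n)) :=
  iter k (mulmx (clock_mx E alpha r tau kappa1 kappa2 p)) z0.

Definition sample_time (R : realType) (t0 tau : R) (k : nat) : R :=
  t0 + k%:R * tau.

Section Coordinates.
Context (R : realType) (n : nat).
Implicit Types (z : 'cV[R]_(n + (n + n))) (r : 'I_n -> R) (xi : 'cV[R]_n).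

Definition xpart z : 'cV[R]_n := usubmx z.
Definition spart z : 'cV[R]_n := usubmx (dsubmx z).
Definition ypart z : 'cV[R]_n := dsubmx (dsubmx z).

Definition gamma r xi : R := (\sum_i xi i 0 / r i)^-1.

Definition tilde_x r xi z : R := gamma r xi * \sum_i xi i 0 / r i * xpart z i 0.
Definition tilde_s r xi z : R := gamma r xi * \sum_i xi i 0 * spart z i 0.
Definition tilde_y r xi z : R := gamma r xi * \sum_i xi i 0 * ypart z i 0.

Definition delta_x r xi z : 'cV[R]_n := \col_i (xpart z i 0 - tilde_x r xi z).
Definition delta_s r xi z : 'cV[R]_n :=
  \col_i (spart z i 0 - tilde_s r xi z / r i).
Definition delta_y r xi z : 'cV[R]_n :=
  \col_i (ypart z i 0 - tilde_y r xi z / r i).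

End Coordinates.

(** The block-diagonal matrices whose blocks are Jordan blocks: only diagonal
    and superdiagonal entries, and each superdiagonal entry is either 0 (block
    boundary) or a 1 between two equal diagonal entries. *)
Definition is_jordan_mx (F : fieldType) (m : nat) (J : 'M[F]_m) : Prop :=
  forall i j : 'I_m,
    if (j : nat) == i.+1 then J i j = 0 \/ (J i j = 1 /\ J i i = J j j)
    else j != i -> J i j = 0.

(** The order [m] of the Jordan form and the order [d] of [A] are allowed to be
    different expressions, so the change of basis [Q] is given with its
    two-sided inverse [P] (which forces [m = d]). *)
Definition jordan_form (F : fieldType) (d m : nat) (A : 'M[F]_d) (J : 'M[F]_m) :
    Prop :=
  is_jordan_mx J /\
  exists (Q : 'M[F]_(d, m)) (P : 'M[F]_(m, d)),
    [/\ Q *m P = 1%:M, P *m Q = 1%:M & A = Q *m J *m P].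

Definition spectral_radius (R : realType) (m : nat) (M : 'M[R[i]]_m) : R :=
  sup [set ComplexField.Normc.normc l | l in [set l | eigenvalue M l]].

Definition Jhat1 (R : realType) (p : R) : 'M[R]_3 :=
  \matrix_(i, j)
    nth 0 (nth [::] [:: [:: 1; 1; 0];
                        [:: 0; 1; 0];
                        [:: 0; 0; 1 - p]] i) j.

Definition complex_mx (R : realType) (m n : nat) (M : 'M[R]_(m, n)) :
    'M[R[i]]_(m, n) :=
  map_mx (real_complex R) M.

(** [J2] completes [Jhat1 p] to a Jordan normal form of [A]; it is unique up to
    the order of its blocks. *)
Definition is_Jhat2 (R : realType) (n : nat) (A : 'M[R]_(n + (n + n))) (p : R)
    (J2 : 'M[R[i]]_(3 * n - 3)) : Prop :=
  jordan_form (complex_mx A) (block_mx (complex_mx (Jhat1 p)) 0 0 J2).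

(* Main.v *)
Require Import Defs.
From mathcomp Require Import all_boot all_order all_algebra.
From mathcomp Require Import complex.
From mathcomp Require Import all_classical all_reals all_analysis.
From mathcomp Require Import ring lra zify.

Set Implicit Arguments.
Unset Strict Implicit.
Unset Printing Implicit Defensive.

Import Order.TTheory GRing.Theory Num.Theory.
Import numFieldNormedType.Exports.

Local Open Scope classical_set_scope.
Local Open Scope ring_scope.

(** The three-dimensional space spanned by [(1, 0, 0)], [(0, 1/r, 0)] and
    [(0, 0, 1/r)] is [A]-invariant, and the common kernel of the averages (tilde
    coordinates) is an invariant complement: for [p <> 0], [A] acts on the
    former as [Jhat1 p] and on the latter as some matrix [B], and the deviations
    (delta coordinates) are the projection onto the complement.  Hence [J2]
    has the characteristic polynomial of [B], and the deviations vanish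
    asymptotically exactly when [B ^+ k] tends to 0, i.e. when all eigenvalues
    of [B] have modulus less than 1.  Conversely, synchronization of the
    [x_i] forces [s_i - rstar / r_i] and [kappa2 * y_i] to tend to 0, so
    [B ^+ k] tends to 0 once [kappa2 != 0]; the other conditions are necessary
    because of explicit solutions that do not synchronize. *)

(** * Invariant splittings and Jordan normal forms *)

Lemma mulmx1_size (F : fieldType) (d m : nat) (Q : 'M[F]_(d, m))
    (P : 'M[F]_(m, d)) : Q *m P = 1%:M -> P *m Q = 1%:M -> m = d.
Proof.
move=> QP PQ; apply/eqP; rewrite eqn_leq.
by rewrite (mulmx1_min PQ) (mulmx1_min QP).
Qed.

(** [Pi = 1 - W C] is an idempotent commuting with [A] whose kernel is the column span of [W]. Its
    rank factorization [Pi = X Y] satisfies [Y X = 1], and [B = Y A X] is the action of [A] on the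
    image of [Pi]. *)
Lemma invariant_splitting (F : fieldType) (d m : nat) (A : 'M[F]_d)
    (M : 'M[F]_m) (W : 'M[F]_(d, m)) (C : 'M[F]_(m, d)) :
    C *m W = 1%:M -> A *m W = W *m M -> C *m A = M *m C ->
  exists m' (B : 'M[F]_m') (X : 'M[F]_(d, m')) (Y : 'M[F]_(m', d)),
    [/\ C *m X = 0, Y *m W = 0 & Y *m X = 1%:M] /\
    [/\ W *m C + X *m Y = 1%:M, A *m X = X *m B & Y *m A = B *m Y].
Proof.
move=> CW AW CA; pose Pi := 1%:M - W *m C.
have PiPi : Pi *m Pi = Pi.
  rewrite /Pi mulmxBr mulmx1 [X in _ - X]mulmxBl mul1mx.
  by rewrite -(mulmxA W) (mulmxA C W) CW mul1mx subrr subr0.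
have PiE : col_base Pi *m row_base Pi = Pi by rewrite mulmx_base.
have CPi : C *m Pi = 0 by rewrite /Pi mulmxBr mulmx1 mulmxA CW mul1mx subrr.
have PiW : Pi *m W = 0 by rewrite /Pi mulmxBl mul1mx -mulmxA CW mulmx1 subrr.
have APi : A *m Pi = Pi *m A.
  by rewrite /Pi mulmxBr mulmxBl mulmx1 mul1mx mulmxA AW -!mulmxA CA.
set X := col_base Pi in PiE; set Y := row_base Pi in PiE.
have /row_freeP[Yr YYr] : row_free Y by exact: row_base_free.
have /row_fullP[Xl XlX] : row_full X by exact: col_base_full.
clearbody X Y.
have YX : Y *m X = 1%:M.
  have : Xl *m (X *m Y *m (X *m Y)) *m Yr = Xl *m (X *m Y) *m Yr.
    by rewrite PiE PiPi.
  by rewrite !mulmxA XlX !mul1mx -!mulmxA YYr !mulmx1.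
have CX : C *m X = 0.
  by rewrite -[X]mulmx1 -YYr (mulmxA X) PiE mulmxA CPi mul0mx.
have YW : Y *m W = 0.
  by rewrite -[Y]mul1mx -XlX -(mulmxA Xl) PiE -mulmxA PiW mulmx0.
have PiX : Pi *m X = X.
  by have /esym := congr1 (mulmx^~ X) PiE; rewrite -mulmxA YX mulmx1.
have YPi : Y *m Pi = Y.
  by have /esym := congr1 (mulmx Y) PiE; rewrite mulmxA YX mul1mx.
exists (\rank Pi), (Y *m A *m X), X, Y; split; split=> //.
- by rewrite PiE addrC subrK.
- by rewrite !mulmxA PiE -APi -mulmxA PiX.
- by rewrite -!mulmxA PiE APi !mulmxA YPi.
Qed.

Lemma split_mulmx1 (F : fieldType) (d m m' : nat) (W : 'M[F]_(d, m))
    (C : 'M[F]_(m, d)) (X : 'M[F]_(d, m')) (Y : 'M[F]_(m', d)) :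
    C *m W = 1%:M -> C *m X = 0 -> Y *m W = 0 -> Y *m X = 1%:M ->
    W *m C + X *m Y = 1%:M ->
  row_mx W X *m col_mx C Y = 1%:M /\ col_mx C Y *m row_mx W X = 1%:M.
Proof.
move=> CW CX YW YX WC; split; first by rewrite mul_row_col.
by rewrite mul_col_row CW CX YW YX -scalar_mx_block.
Qed.

Lemma split_similar (F : fieldType) (d m m' : nat) (A : 'M[F]_d)
    (M : 'M[F]_m) (B : 'M[F]_m') (W : 'M[F]_(d, m))
    (C : 'M[F]_(m, d)) (X : 'M[F]_(d, m')) (Y : 'M[F]_(m', d)) :
    W *m C + X *m Y = 1%:M -> A *m W = W *m M -> A *m X = X *m B ->
  A = row_mx W X *m block_mx M 0 0 B *m col_mx C Y.
Proof.
move=> WC AW AX; rewrite mul_row_block !mulmx0 addr0 add0r mul_row_col.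
by rewrite -AW -AX -!mulmxA -mulmxDr WC mulmx1.
Qed.

(** The superdiagonal entry across the block boundary is 0, which a Jordan matrix allows, and
    shifting both indices by [m] preserves superdiagonal positions. *)
Lemma is_jordan_block_mx (F : fieldType) (m m' : nat) (J : 'M[F]_m)
    (J' : 'M[F]_m') :
  is_jordan_mx (block_mx J 0 0 J') <-> is_jordan_mx J /\ is_jordan_mx J'.
Proof.
split=> [JJ|[jJ jJ'] i j].
  split=> i j.
    by move: (JJ (lshift m' i) (lshift m' j)); rewrite !block_mxEul.
  have := JJ (rshift m i) (rshift m j).
  by rewrite !block_mxEdr /= -addnS eqn_add2l (inj_eq (@rshift_inj _ _)).
case: (split_ordP i) => i' ->; case: (split_ordP j) => j' ->.
- by rewrite !block_mxEul; exact: jJ.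
- by rewrite !block_mxEur !mxE; case: ifP => _; [left|].
- by rewrite !block_mxEdl !mxE; case: ifP => _; [left|].
- rewrite !block_mxEdr /= -addnS eqn_add2l (inj_eq (@rshift_inj _ _)).
  exact: jJ'.
Qed.

(** Only the second summand changes basis, by the factor [block_mx 1%:M 0 0 Q']. *)
Lemma jordan_form_split (F : fieldType) (d m m' k : nat) (A : 'M[F]_d)
    (M : 'M[F]_m) (B : 'M[F]_m') (J : 'M[F]_k) (Q : 'M[F]_(d, m + m'))
    (P : 'M[F]_(m + m', d)) :
    Q *m P = 1%:M -> P *m Q = 1%:M -> A = Q *m block_mx M 0 0 B *m P ->
  is_jordan_mx M -> jordan_form B J -> jordan_form A (block_mx M 0 0 J).
Proof.
move=> QP PQ AE jM [jJ [Q' [P' [QP' PQ' BE]]]]; split.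
  by apply/is_jordan_block_mx.
exists (Q *m block_mx 1%:M 0 0 Q'), (block_mx 1%:M 0 0 P' *m P); split.
- rewrite -mulmxA (mulmxA _ _ P) mulmx_block !(mul0mx, mulmx0, addr0, add0r).
  by rewrite mul1mx QP' -scalar_mx_block mul1mx.
- rewrite -mulmxA (mulmxA P) PQ mul1mx mulmx_block.
  rewrite !(mul0mx, mulmx0, addr0, add0r).
  by rewrite mul1mx PQ' -scalar_mx_block.
- rewrite {}AE {}BE -!(mulmxA Q); congr (Q *m _); rewrite !mulmxA.
  congr (_ *m P); rewrite !mulmx_block !(mul0mx, mulmx0, addr0, add0r).
  by rewrite mul1mx mulmx1.
Qed.

(** * Existence of Jordan forms over an algebraically closed field *)

Definition jordan_block (F : fieldType) (k : nat) (a : F) : 'M[F]_k :=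
  \matrix_(i, j) if j == i then a else (j == i.+1 :> nat)%:R.

Lemma jordan_block_is_jordan (F : fieldType) (k : nat) (a : F) :
  is_jordan_mx (jordan_block k a).
Proof.
move=> i j; rewrite !mxE !eqxx; case: ifP => [/eqP ji|ji]; last first.
  by rewrite ji => /negPf->.
by rewrite -val_eqE /= ji eqxx gtn_eqF //; right.
Qed.

Lemma mulmx_jordan_block0 (F : fieldType) (m k : nat) (M : 'M[F]_(m, k.+1))
    s l :
  (M *m jordan_block k.+1 0) s l = if (0 < l)%N then M s (inord l.-1) else 0.
Proof.
rewrite mxE; case: ifP => l0; last first.
  move/negbT: l0; rewrite lt0n negbK => /eqP l0.
  by rewrite big1 // => t _; rewrite mxE l0; case: ifP => _; rewrite mulr0.
have lE : (inord l.-1 : 'I_k.+1) = l.-1 :> nat.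
  by rewrite inordK // (leq_ltn_trans (leq_pred _)).
rewrite (bigD1 (inord l.-1)) //= big1 => [|t tl].
  rewrite mxE -val_eqE /= lE prednK // eqxx addr0.
  by rewrite gtn_eqF ?mulr1 // prednK.
rewrite mxE; case: ifP => _; rewrite ?mulr0 //.
rewrite (_ : _ == _ = false) ?mulr0 //; apply: contra_neqF tl => /eqP lt.
by apply: val_inj; rewrite /= lE lt.
Qed.

Lemma jordan_block0_mulmx (F : fieldType) (m k : nat) (M : 'M[F]_(k.+1, m))
    l s :
  (jordan_block k.+1 0 *m M) l s =
  if (l.+1 < k.+1)%N then M (inord l.+1) s else 0.
Proof.
rewrite mxE; case: ifP => lk; last first.
  rewrite big1 // => t _; rewrite mxE; case: ifP => _; rewrite ?mul0r //.
  rewrite (_ : _ == _ = false) ?mul0r //; apply: contraFF lk => /eqP <-.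
  exact: ltn_ord.
have lE : (inord l.+1 : 'I_k.+1) = l.+1 :> nat by rewrite inordK.
rewrite (bigD1 (inord l.+1)) //= big1 => [|t tl].
  by rewrite mxE -val_eqE /= lE eqxx addr0 gtn_eqF ?mul1r.
rewrite mxE; case: ifP => _; rewrite ?mul0r //.
rewrite (_ : _ == _ = false) ?mul0r //; apply: contra_neqF tl => /eqP lt.
by apply: val_inj; rewrite /= lE lt.
Qed.

(* If [(X - a)^k] exactly divides the minimal polynomial of [A] with cofactor
   [q], then with [N = A - a] and [g = q(A)] some entry of [N^(k-1) g^2] is
   nonzero while [N^k g = 0]: this entry pairs a column Jordan chain with a
   row Jordan chain nondegenerately, which splits off a Jordan block. *)
Lemma jordan_block_splits (F : closedFieldType) (d : nat) (A : 'M[F]_d.+1) :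
  exists k a (W : 'M[F]_(d.+1, k.+1)) (C : 'M[F]_(k.+1, d.+1)),
    [/\ C *m W = 1%:M, A *m W = W *m jordan_block k.+1 a &
        C *m A = jordan_block k.+1 a *m C].
Proof.
have [a pa0] : exists a, root (mxminpoly A) a.
  apply/closed_rootP; rewrite size_mxminpoly neq_ltn ltnS.
  by rewrite mxminpoly_nonconstant orbT.
have p0 : mxminpoly A != 0 by rewrite monic_neq0 ?mxminpoly_monic.
have [[|k] [q /implyP/(_ p0) qa pE]] := multiplicity_XsubC (mxminpoly A) a.
  by move: pa0; rewrite pE expr0 mulr1 (negPf qa).
set c := 'X - a%:P in pE.
pose N := A - a%:M; pose g := horner_mx A q.
have NE : horner_mx A c = N by rewrite rmorphB /= horner_mx_X horner_mx_C.
have Ng0 : N ^+ k.+1 * g = 0.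
  by rewrite -NE -rmorphXn -rmorphM mulrC /= -pE mx_root_minpoly.
have cNg : GRing.comm N g.
  by rewrite /GRing.comm -NE /g -!rmorphM mulrC.
have AE : A = a%:M + N by rewrite addrC subrK.
have [i [j Nij]] : exists i j, (N ^+ k * g ^+ 2) i j != 0.
  apply/matrix0Pn/eqP.
  (* If this matrix vanished, the minimal polynomial [q c^(k+1)] would divide [c^k q^2]; then [c]
     would divide [q^2] and [a] would be a root of [q]. *)
  rewrite -NE -!rmorphXn -rmorphM /= => /mxminpoly_min.
  rewrite [mxminpoly A]pE exprS mulrA [c ^+ k * _]mulrC dvdp_mul2r; last first.
    by rewrite expf_neq0 // polyXsubC_eq0.
  move=> /(dvdp_trans (dvdp_mull q (dvdpp c))); rewrite dvdp_XsubCl.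
  by rewrite rootE !hornerE expf_eq0 -rootE (negPf qa).
pose e := (N ^+ k * g ^+ 2) i j.
pose W : 'M[F]_(d.+1, k.+1) := \matrix_(s, l) (N ^+ (k - l) * g) s j.
pose C : 'M[F]_(k.+1, d.+1) := \matrix_(l, s) (N ^+ l * g) i s.
pose G := C *m W; pose J := jordan_block k.+1 a.
have N0 l : (k < l)%N -> N ^+ l * g = 0.
  by move=> kl; rewrite -(subnK kl) exprD -mulrA Ng0 mulr0.
have GE l1 l2 : G l1 l2 = (N ^+ (k + l1 - l2) * g ^+ 2) i j.
  have -> : N ^+ (k + l1 - l2) * g ^+ 2 = N ^+ l1 * g * (N ^+ (k - l2) * g).
    have cN : N ^+ (k - l2) * g = g * N ^+ (k - l2).
      exact: commr_sym (commrX _ (commr_sym cNg)).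
    have -> : (k + l1 - l2 = l1 + (k - l2))%N.
      by rewrite addnC addnBA // -ltnS.
    by rewrite exprD expr2 !mulrA -[_ * g * N ^+ _]mulrA -cN !mulrA.
  by rewrite mxE [RHS]mxE; apply: eq_bigr => s _; rewrite !mxE.
(* Below the diagonal the exponent of [N] exceeds [k], so [G] is upper triangular, and every
   diagonal entry equals [e]. *)
have Gdet : \det G != 0.
  rewrite -det_tr det_trig; last first.
    apply/is_trig_mxP => l1 l2 l12.
    rewrite mxE GE expr2 mulrA N0 ?mul0r ?mxE //.
    by have := ltn_ord l1; move: l12; lia.
  rewrite prodf_seq_neq0; apply/allP => l _ /=.
  by rewrite mxE GE addnK.
have Gu : G \in unitmx by rewrite unitmxE unitfE.
have NW : N *m W = W *m jordan_block k.+1 0.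
  apply/matrixP => s l; rewrite mulmx_jordan_block0.
  have -> : (N *m W) s l = (N ^+ (k - l).+1 * g) s j.
    by rewrite exprS -mulrA mxE [RHS]mxE; apply: eq_bigr => t _; rewrite !mxE.
  case: ifP => l0; last first.
    by move/negbT: l0; rewrite -eqn0Ngt => /eqP->; rewrite subn0 Ng0 mxE.
  rewrite [RHS]mxE inordK ?(leq_ltn_trans (leq_pred _)) //.
  by rewrite (_ : (k - l.-1 = (k - l).+1)%N) //; have := ltn_ord l; lia.
have CN : C *m N = jordan_block k.+1 0 *m C.
  apply/matrixP => l s; rewrite jordan_block0_mulmx.
  have -> : (C *m N) l s = (N ^+ l.+1 * g) i s.
    rewrite exprSr -mulrA cNg mulrA mxE [RHS]mxE.
    by apply: eq_bigr => t _; rewrite !mxE.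
  case: ifP => lk; first by rewrite [RHS]mxE inordK.
  by rewrite N0 ?mxE // leqNgt lk.
have JE : J = a%:M + jordan_block k.+1 0.
  apply/matrixP => l1 l2; rewrite !mxE [l2 == l1]eq_sym.
  by case: eqVneq => _; rewrite ?mulr1n ?mulr0n ?addr0 ?add0r.
have AW : A *m W = W *m J.
  by rewrite {1}AE JE mulmxDl mulmxDr NW mul_scalar_mx mul_mx_scalar.
have CA : C *m A = J *m C.
  by rewrite {1}AE JE mulmxDl mulmxDr CN mul_scalar_mx mul_mx_scalar.
(* Multiplying [C] by the inverse of [G] makes it dual to [W]. The relation with [A] survives
   because [G] commutes with [J]: both products equal [C A W]. *)
exists k, a, W, (invmx G *m C); split => //.
- by rewrite -mulmxA mulVmx.
- have GJ : G *m J = J *m G by rewrite /G -mulmxA -AW mulmxA CA mulmxA.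
  rewrite -mulmxA CA !mulmxA; congr (_ *m C).
  by apply: (can_inj (mulmxK Gu)); rewrite -mulmxA -GJ mulKmx // mulmxKV.
Qed.

(** Strong induction on the dimension: a Jordan block splits off, and its invariant complement is
    strictly smaller. *)
Lemma jordan_form_exists (F : closedFieldType) (d : nat) (A : 'M[F]_d) :
  exists m (J : 'M[F]_m), jordan_form A J.
Proof.
elim: {d}_.+1 {-2}d (ltnSn d) A => // b IH [|d] db A.
  exists 0, 0; split; first by case.
  by exists 0, 0; split; rewrite [LHS]flatmx0 [RHS]flatmx0.
have [k [a [W [C [CW AW CA]]]]] := jordan_block_splits A.
have [m' [B [X [Y [[CX YW YX] [WC AX YA]]]]]] := invariant_splitting CW AW CA.
have [QP PQ] := split_mulmx1 CW CX YW YX WC.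
have dE := mulmx1_size QP PQ.
have [m [J jJ]] : exists m (J : 'M[F]_m), jordan_form B J.
  by apply: IH; rewrite -ltnS (leq_trans _ db) // -dE !ltnS leq_addl.
exists (k.+1 + m), (block_mx (jordan_block k.+1 a) 0 0 J).
apply: jordan_form_split QP PQ (split_similar WC AW AX) _ jJ.
exact: jordan_block_is_jordan.
Qed.

(** * Powers of matrices and the spectral radius *)

Local Notation normc := ComplexField.Normc.normc.

Lemma normc_nonneg (R : realType) (x : R[i]) : 0 <= normc x.
Proof. by case: x => a b; exact: sqrtr_ge0. Qed.

Lemma normcX (R : realType) (x : R[i]) k : normc (x ^+ k) = normc x ^+ k.
Proof.
elim: k => [|k IH]; first by rewrite !expr0 ComplexField.Normc.normc1.
by rewrite !exprS ComplexField.Normc.normcM IH.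
Qed.

Lemma normc_real (R : realType) (a : R) : normc (real_complex R a) = `|a|.
Proof. by rewrite /= expr0n /= addr0 sqrtr_sqr. Qed.

Lemma normc_sum (R : realType) (I : Type) (s : seq I) (P : pred I)
    (F : I -> R[i]) :
  normc (\sum_(i <- s | P i) F i) <= \sum_(i <- s | P i) normc (F i).
Proof.
elim/big_ind2: _ => [|x x' y y' xx' yy'|//].
- by rewrite ComplexField.Normc.normc0.
- exact: le_trans (le_normcD _ _) (lerD xx' yy').
Qed.

Lemma cvg_sum0 (R : realType) (I : Type) (s : seq I) (P : pred I)
    (f : I -> nat -> R) :
  (forall i, P i -> f i k @[k --> \oo] --> 0) ->
  \sum_(i <- s | P i) f i k @[k --> \oo] --> 0.
Proof.
move=> f0; elim: s => [|i s IH].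
  by under eq_cvg do rewrite big_nil; exact: cvg_cst.
under eq_cvg do rewrite big_cons.
case Pi: (P i); last exact: IH.
by have := cvgD (f0 i Pi) IH; rewrite addr0; apply.
Qed.

Lemma cvg0_mull (R : realType) (c : R) (u : nat -> R) :
  u k @[k --> \oo] --> 0 -> c * u k @[k --> \oo] --> 0.
Proof. by move=> u0; have := cvgM (cvg_cst c) u0; rewrite mulr0; apply. Qed.

Lemma squeeze0 (R : realType) (u v : nat -> R) :
    (forall k, 0 <= u k <= v k) -> v k @[k --> \oo] --> 0 ->
  u k @[k --> \oo] --> 0.
Proof.
move=> uv v0; apply: (squeeze_cvgr _ (cvg_cst 0) v0).
exact: nearW.
Qed.

(** From some [N] on, [b] is at most [(1 - q) * (e / 2)], and the recursion then preserves the bound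
    [e / 2 + q ^+ j * u N], whose second term is eventually below [e / 2]. *)
Lemma affine_decay (R : realType) (u b : nat -> R) (q : R) :
    0 <= q < 1 -> (forall k, 0 <= u k) ->
    (forall k, u k.+1 <= q * u k + b k) -> b k @[k --> \oo] --> 0 ->
  u k @[k --> \oo] --> 0.
Proof.
move=> /andP[q0 q1] u0 uS b0; apply/cvgr0Pnorm_le => e e0.
have d0 : 0 < (1 - q) * (e / 2) by rewrite mulr_gt0 ?subr_gt0 ?divr_gt0.
have [N _ bN] := (cvgr0Pnorm_le b).1 b0 _ d0.
have uN j : u (j + N)%N <= e / 2 + q ^+ j * u N.
  elim: j => [|j IH]; first by rewrite add0n expr0 mul1r lerDr ltW ?divr_gt0.
  rewrite addSn (le_trans (uS _)) //.
  have bj : b (j + N)%N <= (1 - q) * (e / 2).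
    by rewrite (le_trans (ler_norm _)) // bN /= ?leq_addl.
  have := ler_wpM2l q0 IH; rewrite exprS; lra.
have : q ^+ j * u N @[j --> \oo] --> 0.
  under eq_cvg do rewrite mulrC; apply: cvg0_mull; apply: cvg_expr.
  by rewrite ger0_norm.
move=> /cvgr0Pnorm_le/(_ (e / 2)) []; first by rewrite divr_gt0.
move=> M _ qM; exists (M + N)%N => // k /= MNk.
rewrite ger0_norm // -(subnK (leq_trans (leq_addl M N) MNk)).
apply: le_trans (uN _) _; rewrite [leRHS]splitr lerD2l.
by apply: le_trans (ler_norm _) _; apply: qM => /=; lia.
Qed.

Lemma normc_affine_decay (R : realType) (u : nat -> R[i]) (l : R[i]) :
    normc l < 1 -> normc (u k.+1 - l * u k) @[k --> \oo] --> 0 ->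
  normc (u k) @[k --> \oo] --> 0.
Proof.
move=> l1; apply: (@affine_decay _ (fun k => normc (u k)) _ (normc l)).
- by rewrite normc_nonneg.
- by move=> k; exact: normc_nonneg.
move=> k; rewrite -ComplexField.Normc.normcM addrC.
rewrite -{1}[u k.+1](subrK (l * u k)).
exact: le_normcD.
Qed.

(* A sequence [u] with [u (k+1) - l * u k] tending to 0 and [|l| < 1] tends to 0
   itself, so the linear factors can be stripped off one at a time; by
   Cayley-Hamilton one may start from the characteristic polynomial. *)
Lemma mx_powers_decay_prod (R : realType) (d : nat) (M : 'M[R[i]]_d.+1)
    (s : seq R[i]) (p : {poly R[i]}) :
    (forall l, l \in s -> normc l < 1) ->
    (forall i j, normc ((horner_mx M (p * \prod_(l <- s) ('X - l%:P))
                         * M ^+ k) i j) @[k --> \oo] --> 0) ->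
  forall i j, normc ((horner_mx M p * M ^+ k) i j) @[k --> \oo] --> 0.
Proof.
elim: s p => [|l s IH] p s1; first by rewrite big_nil mulr1.
rewrite big_cons mulrA => H i j.
have {}s1' x (xs : x \in s) : normc x < 1 by rewrite s1 // inE xs orbT.
have {}IH := IH (p * ('X - l%:P)) s1' H.
apply: (@normc_affine_decay _ _ l); first by rewrite s1 ?mem_head.
apply: cvg_trans (IH i j); apply: near_eq_cvg; near=> k; congr normc.
rewrite rmorphM rmorphB /= horner_mx_X horner_mx_C mulrBr mulrBl.
rewrite -mulrA -exprS mxE; congr (_ + _); rewrite mxE; congr (- _).
by rewrite -scalemx1 -scalerAr mulr1 -scalerAl mxE.
Unshelve. all: by end_near. Qed.

Lemma mx_powers_decay (R : realType) (d : nat) (M : 'M[R[i]]_d.+1) :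
    (forall l, root (char_poly M) l -> normc l < 1) ->
  forall i j, normc ((M ^+ k) i j) @[k --> \oo] --> 0.
Proof.
move=> M1; have [s sE] := closed_field_poly_normal (char_poly M).
rewrite (monicP (char_poly_monic M)) scale1r in sE => i j.
suff : normc ((horner_mx M 1 * M ^+ k) i j) @[k --> \oo] --> 0.
  by under eq_cvg do rewrite rmorph1 mul1r.
apply: (@mx_powers_decay_prod _ _ _ s) => [l ls|i' j'].
  by apply: M1; rewrite sE root_prod_XsubC.
under eq_cvg do rewrite mul1r -sE Cayley_Hamilton mul0r mxE.
by rewrite ComplexField.Normc.normc0; exact: cvg_cst.
Qed.

(** All terms have modulus at least [normc c], so the limit 0 bounds it. *)
Lemma le1_powers_decay (R : realType) (l c : R[i]) :
    1 <= normc l -> normc (l ^+ k * c) @[k --> \oo] --> 0 -> c = 0.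
Proof.
move=> l1 lc; apply: ComplexField.Normc.eq0_normc; apply/eqP.
rewrite eq_le normc_nonneg andbT.
apply: (ler_cvg_to (cvg_cst _) lc); near=> k.
rewrite ComplexField.Normc.normcM normcX.
by rewrite ler_peMl ?normc_nonneg // exprn_ege1.
Unshelve. all: by end_near. Qed.

Lemma left_eigen_iter (F : fieldType) (d : nat) (M : 'M[F]_d) (l : F)
    (v : 'rV_d) k : v *m M = l *: v -> v *m M ^+ k = l ^+ k *: v.
Proof.
move=> vM; elim: k => [|k IH]; first by rewrite !expr0 mulmx1 scale1r.
by rewrite exprS mulmxA vM -scalemxAl IH scalerA -exprS.
Qed.

(** A left eigenvector satisfies [v M^k = l^k v]. The left side tends to 0, so [1 <= normc l] would
    force every coordinate of [v] to vanish. *)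
Lemma decay_eigenvalue (R : realType) (d : nat) (M : 'M[R[i]]_d) (l : R[i]) :
    (forall i j, normc ((M ^+ k) i j) @[k --> \oo] --> 0) ->
  eigenvalue M l -> normc l < 1.
Proof.
move=> M0 /eigenvalueP[v vM v0]; rewrite ltNge; apply/negP => l1.
move/eqP: v0; apply; apply/rowP => j; rewrite mxE.
apply: (le1_powers_decay l1).
apply: (@squeeze0 _ _ (fun k => \sum_i normc (v 0 i) * normc ((M ^+ k) i j))).
  move=> k; rewrite normc_nonneg /=.
  have -> : l ^+ k * v 0 j = (v *m M ^+ k) 0 j.
    by rewrite (left_eigen_iter _ vM) mxE.
  rewrite mxE (le_trans (normc_sum _ _ _)) //.
  by rewrite ler_sum // => i _; rewrite ComplexField.Normc.normcM.
apply: cvg_sum0 => i _.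
exact: cvg0_mull.
Qed.

(** The eigenvalues are the roots of the characteristic polynomial, a finite list [s], so the
    supremum is bounded by a maximum and the strict inequality is kept. *)
Lemma spectral_radius_lt1 (R : realType) (d : nat) (M : 'M[R[i]]_d) :
  spectral_radius M < 1 <->
  forall l, root (char_poly M) l -> normc l < 1.
Proof.
have [s sE] := closed_field_poly_normal (char_poly M).
rewrite (monicP (char_poly_monic M)) scale1r in sE.
have rootE l : root (char_poly M) l = (l \in s) by rewrite sE root_prod_XsubC.
pose c := \big[Num.max/0]_(l <- s) normc l.
set S := [set normc l | l in [set l | eigenvalue M l]].
have Sub : ubound S c.
  move=> _ [l /= + <-]; rewrite eigenvalue_root_char rootE => ls.
  by rewrite /c; apply: le_bigmax_seq.
split=> [S1 l lr|M1]; first apply: le_lt_trans S1.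
  apply: ub_le_sup; first by exists c.
  by exists l => //=; rewrite eigenvalue_root_char.
rewrite /spectral_radius -/S.
(* Without eigenvalues, that is for [d = 0], [sup] takes its default value 0. *)
have [->|S0] := eqVneq S set0; first by rewrite sup0.
rewrite (le_lt_trans (ge_sup _ Sub)) //; first exact/set0P.
rewrite /c big_seq; elim/big_ind: _ => // [x y x1 y1|l ls].
  by rewrite gt_max x1.
by apply: M1; rewrite rootE.
Qed.

(** * The clock matrix and its invariant subspaces *)

(* A node with the fewest reachable nodes is reachable from everything it
   reaches, hence from every node whose reachable set meets its own. *)
Lemma disconnected_reach (n : nat) (E : rel 'I_n) :
    (0 < n)%N -> ~ connected_digraph E ->
  exists u v, forall w, connect E u w -> connect E v w -> False.
Proof.
case: n E => // n E _ Ec; apply: contrapT => H; apply: Ec.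
have common u v : exists w, connect E u w /\ connect E v w.
  apply: contrapT => uv; apply: H; exists u, v => w uw vw; apply: uv.
  by exists w.
case: (@arg_minnP _ ord0 xpredT (fun u => #|connect E u|)) => // u _ umin.
exists u => v; have [w [uw vw]] := common u v.
apply: connect_trans vw _.
suff /subset_cardP wE : #|connect E w| = #|connect E u|.
  have /wE : connect E w \subset connect E u.
    by apply/fintype.subsetP => x; apply: connect_trans.
  by move=> /(_ u); rewrite !inE connect0.
apply/eqP; rewrite eqn_leq umin // andbT subset_leq_card //.
by apply/fintype.subsetP => x; apply: connect_trans.
Qed.

(** Every row sums to 0. Irreflexivity ensures that each weight in the diagonal entry has its
    opposite off the diagonal. *)
Lemma laplacian_const (R : realType) (n : nat) (E : rel 'I_n)
    (alpha : 'I_n -> 'I_n -> R) (hE : irreflexive E) (m : nat) (a : R) :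
  laplacian E alpha *m (const_mx a : 'M[R]_(n, m)) = 0.
Proof.
apply/matrixP => i j; rewrite !mxE (bigD1 i) //= !mxE eqxx.
rewrite big_mkcond (bigD1 i) //= hE add0r mulr_suml -big_split big1 //= => k ki.
rewrite !mxE eq_sym (negPf ki); case: ifP => _; last by rewrite !mul0r addr0.
by rewrite mulNr subrr.
Qed.

Section ClockAlgebra.
Context (R : realType) (n : nat) (E : rel 'I_n) (alpha : 'I_n -> 'I_n -> R)
  (r : 'I_n -> R) (tau kappa1 kappa2 p : R) (xi : 'cV[R]_n).
Context (hE : irreflexive E) (hr : forall i, 0 < r i) (htau : 0 < tau)
  (hxiL : xi^T *m laplacian E alpha = 0) (hxi_ge0 : forall i, 0 <= xi i 0)
  (hxi_sum : \sum_i xi i 0 = 1).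

Local Notation L := (laplacian E alpha).
Local Notation Rd := (diag_mx (\row_i r i)).
Local Notation A := (clock_mx E alpha r tau kappa1 kappa2 p).
Local Notation z := (clock_state E alpha r tau kappa1 kappa2 p).
Local Notation one := (const_mx 1 : 'cV[R]_n).
Local Notation rinv := (\col_i (r i)^-1 : 'cV[R]_n).
Local Notation cx := (\row_i (gamma r xi * (xi i 0 / r i)) : 'rV[R]_n).
Local Notation cs := (\row_i (gamma r xi * xi i 0) : 'rV[R]_n).

Lemma clock_mx_col (m : nat) (x s y : 'M[R]_(n, m)) :
  A *m col_mx x (col_mx s y) =
  col_mx (x + tau *: (Rd *m s))
         (col_mx (s - kappa1 *: (L *m x) - kappa2 *: y)
                 ((1 - p) *: y - p *: (L *m x))).
Proof.
rewrite /clock_mx mul_block_col mul_row_col mul_block_col mul_col_mx.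
rewrite mul1mx mul0mx addr0 mul1mx mul0mx add0r -scalemxAl add_col_mx.
rewrite -!scalemxAl !scaleNr mulNmx !mul_scalar_mx.
congr (col_mx _ (col_mx _ _)); last by rewrite addrC.
by rewrite addrA [- _ + _]addrC.
Qed.

Lemma row_clock_mx (m : nat) (a b c : 'M[R]_(m, n)) :
  row_mx a (row_mx b c) *m A =
  row_mx (a - kappa1 *: (b *m L) - p *: (c *m L))
         (row_mx (tau *: (a *m Rd) + b) ((1 - p) *: c - kappa2 *: b)).
Proof.
rewrite /clock_mx mul_row_block mul_row_col mul_row_block mul_mx_row.
rewrite !mulmx1 !mulmx0 addr0 -!scalemxAr add_row_mx add0r.
congr row_mx; first by rewrite !scaleNr addrA.
congr row_mx.
by rewrite mulmxN !mul_mx_scalar addrC.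
Qed.

Lemma state_eta (v : 'cV[R]_(n + (n + n))) :
  v = col_mx (xpart v) (col_mx (spart v) (ypart v)).
Proof. by rewrite /xpart /spart /ypart !vsubmxK. Qed.

Lemma xpart_col (x s y : 'cV[R]_n) : xpart (col_mx x (col_mx s y)) = x.
Proof. by rewrite /xpart col_mxKu. Qed.

Lemma spart_col (x s y : 'cV[R]_n) : spart (col_mx x (col_mx s y)) = s.
Proof. by rewrite /spart col_mxKd col_mxKu. Qed.

Lemma ypart_col (x s y : 'cV[R]_n) : ypart (col_mx x (col_mx s y)) = y.
Proof. by rewrite /ypart !col_mxKd. Qed.

Lemma clock_stateS z0 k : z z0 k.+1 = A *m z z0 k.
Proof. by []. Qed.

Lemma clock_state_col z0 k :
  z z0 k.+1 = col_mx (xpart (z z0 k) + tau *: (Rd *m spart (z z0 k)))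
   (col_mx (spart (z z0 k) - kappa1 *: (L *m xpart (z z0 k))
            - kappa2 *: ypart (z z0 k))
           ((1 - p) *: ypart (z z0 k) - p *: (L *m xpart (z z0 k)))).
Proof. by rewrite clock_stateS {1}[z z0 k]state_eta clock_mx_col. Qed.

(** Makes [gamma] a genuine inverse: if the nonnegative terms summed to 0, all [xi i 0] would
    vanish, against their sum 1. *)
Lemma sum_xi_r_gt0 : 0 < \sum_i xi i 0 / r i.
Proof.
have h i : 0 <= xi i 0 / r i by rewrite divr_ge0 // ltW.
rewrite lt_def sumr_ge0 // andbT psumr_eq0 //; apply/negP => /allP xi0.
suff : 1 = 0 :> R by move/eqP; rewrite oner_eq0.
rewrite -hxi_sum big1 // => i _; apply/eqP.
have := xi0 i (mem_index_enum _); rewrite mulf_eq0 invr_eq0.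
by rewrite (gt_eqF (hr i)) orbF.
Qed.

Lemma cx_one : cx *m one = 1%:M.
Proof.
apply/matrixP => i j; rewrite !ord1 !mxE eqxx mulr1n.
under eq_bigr do rewrite !mxE mulr1.
by rewrite -mulr_sumr mulVf // gt_eqF // sum_xi_r_gt0.
Qed.

Lemma cs_rinv : cs *m rinv = 1%:M.
Proof.
rewrite -cx_one; apply/matrixP => i j; rewrite !mxE.
by apply: eq_bigr => k _; rewrite !mxE mulr1 mulrA.
Qed.

Lemma cx_diag : cx *m Rd = cs.
Proof.
apply/rowP => i; rewrite mul_mx_diag !mxE -!mulrA mulVf ?mulr1 //.
by rewrite gt_eqF.
Qed.

Lemma diag_rinv : Rd *m rinv = one.
Proof.
apply/colP => i; rewrite mul_diag_mx !mxE mulfV //.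
by rewrite gt_eqF.
Qed.

Lemma cs_laplacian : cs *m L = 0.
Proof.
have -> : cs = gamma r xi *: xi^T by apply/rowP => i; rewrite !mxE.
by rewrite -scalemxAl hxiL scaler0.
Qed.

(** For [p != 0] these solve [b - kappa2 = (1 - p) * b] and [a + tau * b = (1 - p) * a], the
    conditions for [(a, b / r, 1 / r)] to be an eigenvector for [1 - p]. *)
Let a := - tau * kappa2 / p ^+ 2.
Let b := kappa2 / p.

(* The columns of [Wsync] are eigenvectors of [A] for 1 and [1 - p] (first and
   third) and a generalized one (second), normalized so that [A] acts by
   [Jhat1 p]; the rows of [Csync] are the dual basis built from [xi]. *)
Definition Wsync : 'M[R]_(n + (n + n), 1 + (1 + 1)) :=
  row_mx (col_mx (tau *: one) (col_mx 0 0))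
    (row_mx (col_mx 0 (col_mx rinv 0))
            (col_mx (a *: one) (col_mx (b *: rinv) rinv))).

Definition Csync : 'M[R]_(1 + (1 + 1), n + (n + n)) :=
  col_mx (row_mx (tau^-1 *: cx) (row_mx 0 (- (a / tau) *: cs)))
    (col_mx (row_mx 0 (row_mx cs (- b *: cs)))
            (row_mx 0 (row_mx 0 cs))).

Lemma Jhat1_block : Jhat1 p =
  block_mx 1%:M (row_mx 1%:M 0) 0 (block_mx 1%:M 0 0 (1 - p)%:M)
  :> 'M[R]_(1 + (1 + 1)).
Proof.
apply/matrixP => i j.
case: (split_ordP i) => i' ->; case: (split_ordP j) => j' ->;
  rewrite ?(block_mxEul, block_mxEur, block_mxEdl, block_mxEdr).
- by rewrite !ord1 !mxE.
- by case: (split_ordP j') => j'' ->; rewrite ?(row_mxEl, row_mxEr) !ord1 !mxE.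
- by case: (split_ordP i') => i'' ->; rewrite !ord1 !mxE.
- case: (split_ordP i') => i'' ->; case: (split_ordP j') => j'' ->;
  by rewrite ?(block_mxEul, block_mxEur, block_mxEdl, block_mxEdr) !ord1 !mxE.
Qed.

Lemma Csync_Wsync : Csync *m Wsync = 1%:M.
Proof.
rewrite /Csync /Wsync mul_col_row mul_col_mx mul_mx_row mul_col_row.
rewrite !mul_row_col !(mul0mx, mulmx0, addr0, add0r).
rewrite -!scalemxAl -!scalemxAr cx_one cs_rinv !scalerA.
rewrite !scalar_mx_block mulVf ?gt_eqF // scale1r -scalerDl.
rewrite (_ : tau^-1 * a + - (a / tau) = 0) ?scale0r; last first.
  by rewrite mulrC subrr.
rewrite (_ : b *: 1%:M + - b *: 1%:M = 0) ?row_mx0 ?col_mx0 //.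
by rewrite -scalerDl subrr scale0r.
Qed.

Lemma clock_Wsync : p != 0 ->
  A *m Wsync = Wsync *m (Jhat1 p : 'M[R]_(1 + (1 + 1))).
Proof.
move=> p0; rewrite Jhat1_block /Wsync.
rewrite !mul_mx_row mul_row_block !mul_row_block !clock_mx_col.
rewrite !(mul0mx, mulmx0, addr0, add0r, mulmx1, scaler0, subr0, oppr0).
rewrite -!scalemxAr diag_rinv !laplacian_const // !(scaler0, subr0, oppr0).
rewrite mul_mx_row mulmx1 mulmx0 mul_mx_scalar add_row_mx add0r.
rewrite add_col_mx addr0 add_col_mx add0r addr0 !scale_col_mx !scalerA.
rewrite -scalerDl -scalerBl.
have -> : a + tau * b = (1 - p) * a by rewrite /a /b; field.
by have -> : b - kappa2 = (1 - p) * b by rewrite /b; field.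
Qed.

Lemma Csync_clock : p != 0 ->
  Csync *m A = (Jhat1 p : 'M[R]_(1 + (1 + 1))) *m Csync.
Proof.
move=> p0; rewrite Jhat1_block /Csync.
rewrite mul_block_col mul_block_col mul_row_col !mul_col_mx !row_clock_mx.
rewrite !(mul0mx, mulmx0, addr0, add0r, mul1mx, scaler0, subr0, oppr0).
rewrite -!scalemxAl cx_diag cs_laplacian !(scaler0, subr0, oppr0).
rewrite !add_row_mx !(addr0, add0r) mul_scalar_mx !scale_row_mx !scaler0.
rewrite !scalerA mulfV ?scale1r ?gt_eqF // -(scaleNr kappa2 cs) -!scalerDl.
have -> : (1 - p) * - (a / tau) = - (a / tau) - b.
  by rewrite /a /b; field; rewrite p0 gt_eqF.
by have -> : (1 - p) * - b - kappa2 = - b by rewrite /b; field.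
Qed.

Lemma tilde_xE v : tilde_x r xi v = (cx *m xpart v) 0 0.
Proof.
rewrite mxE /tilde_x mulr_sumr; apply: eq_bigr => i _.
by rewrite !mxE mulrA.
Qed.

Lemma tilde_sE v : tilde_s r xi v = (cs *m spart v) 0 0.
Proof.
rewrite mxE /tilde_s mulr_sumr; apply: eq_bigr => i _.
by rewrite !mxE mulrA.
Qed.

Lemma tilde_yE v : tilde_y r xi v = (cs *m ypart v) 0 0.
Proof.
rewrite mxE /tilde_y mulr_sumr; apply: eq_bigr => i _.
by rewrite !mxE mulrA.
Qed.

(** Identifies the deviations with the projection [1 - W C]; the contributions of [a] and [b] cancel
    in the product. *)
Lemma Wsync_Csync v : Wsync *m (Csync *m v) =
  v - col_mx (delta_x r xi v) (col_mx (delta_s r xi v) (delta_y r xi v)).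
Proof.
rewrite [v in Csync *m v]state_eta /Csync /Wsync !mul_col_mx !mul_row_col.
rewrite !(mul0mx, mulmx0, addr0, add0r).
rewrite -!scalemxAl.
have -> : cx *m xpart v = (tilde_x r xi v)%:M.
  by rewrite [LHS]mx11_scalar -tilde_xE.
have -> : cs *m spart v = (tilde_s r xi v)%:M.
  by rewrite [LHS]mx11_scalar -tilde_sE.
have -> : cs *m ypart v = (tilde_y r xi v)%:M.
  by rewrite [LHS]mx11_scalar -tilde_yE.
rewrite !mul_col_mx !mul0mx !add_col_mx !(addr0, add0r).
rewrite [X in _ = X - _]state_eta opp_col_mx add_col_mx opp_col_mx add_col_mx.
rewrite -!scalemxAl !mulmxDr -!scalemxAr !mul_mx_scalar.
congr (col_mx _ (col_mx _ _)); apply/colP => i; rewrite !mxE.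
- by field; rewrite gt_eqF.
- by rewrite /GRing.scale /=; ring.
- by ring.
Qed.

(** The averages form a closed recursion because [cs] annihilates the Laplacian and [cx] times the
    diagonal matrix of the [r i] is [cs]. *)
Lemma tilde_step v :
  [/\ tilde_x r xi (A *m v) = tilde_x r xi v + tau * tilde_s r xi v,
  tilde_s r xi (A *m v) = tilde_s r xi v - kappa2 * tilde_y r xi v &
  tilde_y r xi (A *m v) = (1 - p) * tilde_y r xi v].
Proof.
rewrite !tilde_xE !tilde_sE !tilde_yE [v in A *m v]state_eta clock_mx_col.
rewrite xpart_col spart_col ypart_col; split.
- by rewrite mulmxDr -scalemxAr mulmxA cx_diag !mxE.
- by rewrite !mulmxBr -!scalemxAr mulmxA cs_laplacian mul0mx scaler0 subr0 !mxE.
- by rewrite !mulmxBr -!scalemxAr mulmxA cs_laplacian mul0mx scaler0 subr0 !mxE.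
Qed.

End ClockAlgebra.

(** * Vanishing sequences, similarity, and passage to complex matrices *)

Lemma cvg_cst0 (R : realType) (c : R) : (fun=> c) k @[k --> \oo] --> 0 -> c = 0.
Proof.
move=> c0; apply/eqP; rewrite eq_le; apply/andP; split.
- by apply: (ler_cvg_to (cvg_cst c) c0); exact: nearW.
- by apply: (ler_cvg_to c0 (cvg_cst c)); exact: nearW.
Qed.

Lemma cvg_shift0 (R : realType) (u : nat -> R) :
  u k @[k --> \oo] --> 0 -> u k.+1 @[k --> \oo] --> 0.
Proof. by move=> u0; rewrite (cvg_shiftS u). Qed.

Lemma cvg0B (R : realType) (u v : nat -> R) : u k @[k --> \oo] --> 0 ->
  v k @[k --> \oo] --> 0 -> u k - v k @[k --> \oo] --> 0.
Proof. by move=> u0 v0; have := cvgB u0 v0; rewrite subr0; apply. Qed.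

Lemma cvgD0 (R : realType) (l : R) (u v : nat -> R) : u k @[k --> \oo] --> l ->
  v k @[k --> \oo] --> 0 -> u k + v k @[k --> \oo] --> l.
Proof. by move=> ul v0; have := cvgD ul v0; rewrite addr0; apply. Qed.

Lemma cvg_eq1 (R : realType) (l : R) (u v : nat -> R) : u =1 v ->
  u k @[k --> \oo] --> l -> v k @[k --> \oo] --> l.
Proof. by move=> /funext ->. Qed.

Lemma cvg_mulmx0 (R : realType) (m n : nat) (M : 'M[R]_(m, n))
    (u : nat -> 'cV[R]_n) :
  (forall i, u k i 0 @[k --> \oo] --> 0) ->
  forall i, (M *m u k) i 0 @[k --> \oo] --> 0.
Proof.
move=> u0 i; under eq_cvg do rewrite mxE.
by apply: cvg_sum0 => j _; exact: cvg0_mull.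
Qed.

Lemma cvg_col0P (R : realType) (n : nat) (u : nat -> 'cV[R]_n) :
  (u k @[k --> \oo] --> (0 : 'cV[R]_n)) <->
  (forall i, u k i 0 @[k --> \oo] --> 0).
Proof.
split=> [u0 i|u0].
  have := continuous_cvg _ (@coord_continuous R n 1 i 0 0) u0.
  by rewrite mxE; apply.
apply/cvgr0Pnorm_le => e e0.
have : \forall k \near \oo, forall i, `|u k i 0| <= e.
  by apply: filter_forall => i; move/cvgr0Pnorm_le: (u0 i); apply.
apply: filterS => k uk; rewrite /Num.norm /= mx_normrE.
by apply: bigmax_le => [|[i j] _]; [exact: ltW|rewrite ord1].
Qed.

(** The difference of consecutive terms is the constant [a], which must be 0; then the sequence is
    the constant [b]. *)
Lemma cvg_affine0 (R : realType) (a b : R) :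
  a * k%:R + b @[k --> \oo] --> 0 -> a = 0 /\ b = 0.
Proof.
move=> ab0; have a0 : a = 0.
  apply: cvg_cst0; apply: cvg_eq1 (cvg0B (cvg_shift0 ab0) ab0) => k.
  by rewrite -natr1; ring.
split=> //; apply: cvg_cst0; apply: cvg_eq1 ab0 => k.
by rewrite a0 mul0r add0r.
Qed.

Lemma char_poly_similar (F : fieldType) (d m : nat) (A : 'M[F]_d)
    (J : 'M[F]_m) (Q : 'M[F]_(d, m)) (P : 'M[F]_(m, d)) :
    Q *m P = 1%:M -> P *m Q = 1%:M -> A = Q *m J *m P ->
  char_poly A = char_poly J.
Proof.
move=> QP PQ AE; have md := mulmx1_size QP PQ; subst m.
have AX : char_poly_mx A =
    map_mx polyC Q *m char_poly_mx J *m map_mx polyC P.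
  rewrite /char_poly_mx mulmxBr mulmxBl -!map_mxM -AE; congr (_ - _).
  by rewrite mul_mx_scalar -scalemxAl -map_mxM QP map_mx1 scalemx1.
rewrite /char_poly AX !det_mulmx mulrAC -det_mulmx -map_mxM QP map_mx1 det1.
by rewrite mul1r.
Qed.

Lemma char_poly_block_diag (F : fieldType) (m m' : nat) (M : 'M[F]_m)
    (M' : 'M[F]_m') :
  char_poly (block_mx M 0 0 M') = char_poly M * char_poly M'.
Proof.
rewrite /char_poly /char_poly_mx map_block_mx scalar_mx_block opp_block_mx.
by rewrite add_block_mx !map_mx0 !subr0 det_ublock.
Qed.

Lemma complex_mxM (R : realType) (m n q : nat) (M : 'M[R]_(m, n))
    (N : 'M[R]_(n, q)) : complex_mx (M *m N) = complex_mx M *m complex_mx N.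
Proof. exact: map_mxM. Qed.

Lemma complex_mxX (R : realType) (m : nat) (M : 'M[R]_m) k :
  complex_mx (M ^+ k) = complex_mx M ^+ k.
Proof.
elim: k => [|k IH]; first by rewrite !expr0 /complex_mx map_mx1.
by rewrite !exprS -IH; exact: complex_mxM.
Qed.

Lemma complex_mx_powers_decay (R : realType) (m : nat) (M : 'M[R]_m) :
  (forall l, root (char_poly (complex_mx M)) l -> normc l < 1) ->
  forall i j, (M ^+ k) i j @[k --> \oo] --> 0.
Proof.
case: m M => [|m] M M1 i j; first by case: i.
apply: norm_cvg0.
apply: cvg_eq1 (mx_powers_decay M1 i j) => k.
by rewrite -complex_mxX mxE normc_real.
Qed.

Lemma complex_mx_decay_eigenvalue (R : realType) (m : nat) (M : 'M[R]_m) l :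
  (forall i j, (M ^+ k) i j @[k --> \oo] --> 0) ->
  eigenvalue (complex_mx M) l -> normc l < 1.
Proof.
move=> M0; apply: decay_eigenvalue => i j.
apply: (@cvg_eq1 _ _ (fun k => `|(M ^+ k) i j|)) => [k|].
  by rewrite -complex_mxX mxE normc_real.
exact/norm_cvg0P.
Qed.

Lemma decay_ratio (R : realType) (q : R) :
  q ^+ k @[k --> \oo] --> 0 -> `|q| < 1.
Proof.
move=> q0; rewrite ltNge; apply/negP => q1.
suff : (1 : R[i]) = 0 by move/eqP; rewrite oner_eq0.
apply: (@le1_powers_decay R (real_complex R q)); first by rewrite normc_real.
apply: (@cvg_eq1 _ _ (fun k => `|q ^+ k|)); last exact/norm_cvg0P.
by move=> k; rewrite mulr1 -rmorphXn normc_real.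
Qed.

Lemma Jhat1_is_jordan (R : realType) (p : R) :
  is_jordan_mx (complex_mx (Jhat1 p)).
Proof.
move=> [[|[|[|i]]] hi] // [[|[|[|j]]] hj] //=; rewrite !mxE //=.
- by right.
- by left.
Qed.

(** * Synchronization and stability *)

Section Synchronization.
Context (R : realType) (n : nat) (E : rel 'I_n) (alpha : 'I_n -> 'I_n -> R)
  (r : 'I_n -> R) (t0 tau kappa1 kappa2 p : R) (xi : 'cV[R]_n).
Context (hn : (2 <= n)%N) (hE : irreflexive E) (hr : forall i, 0 < r i)
  (htau : 0 < tau)
  (hxiL : xi^T *m laplacian E alpha = 0) (hxi_ge0 : forall i, 0 <= xi i 0)
  (hxi_sum : \sum_i xi i 0 = 1).

Local Notation L := (laplacian E alpha).
Local Notation Rd := (diag_mx (\row_i r i)).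
Local Notation A := (clock_mx E alpha r tau kappa1 kappa2 p).
Local Notation z := (clock_state E alpha r tau kappa1 kappa2 p).
Local Notation one := (const_mx 1 : 'cV[R]_n).
Local Notation rinv := (\col_i (r i)^-1 : 'cV[R]_n).
Local Notation cx := (\row_i (gamma r xi * (xi i 0 / r i)) : 'rV[R]_n).
Local Notation cs := (\row_i (gamma r xi * xi i 0) : 'rV[R]_n).
Local Notation aff rs xs k := (rs * (sample_time t0 tau k - t0) + xs).

Definition tracks (z0 : 'cV[R]_(n + (n + n))) (rs xs : R) :=
  forall i : 'I_n, xpart (z z0 k) i 0 - aff rs xs k @[k --> \oo] --> (0 : R).

Definition clock_sync := forall z0, exists rs xs, tracks z0 rs xs.

Lemma sample_timeB k : sample_time t0 tau k - t0 = k%:R * tau.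
Proof. by rewrite /sample_time addrC addKr. Qed.

(** The increment of the tracking error of node [i] is [tau * r i] times the quantity in
    question. *)
Lemma tracks_spart z0 rs xs : tracks z0 rs xs ->
  forall i, spart (z z0 k) i 0 - rs / r i @[k --> \oo] --> 0.
Proof.
move=> zx i; pose d k := xpart (z z0 k) i 0 - aff rs xs k.
apply: (@cvg_eq1 _ _ (fun k => (tau * r i)^-1 * (d k.+1 - d k))) => [k|].
  rewrite /d clock_state_col xpart_col mul_diag_mx !sample_timeB -natr1 !mxE.
  by field; rewrite !gt_eqF.
by apply: cvg0_mull; apply: cvg0B (zx i); exact: cvg_shift0 (zx i).
Qed.

Lemma tracks_deviation z0 rs xs : tracks z0 rs xs ->
  forall i, (xpart (z z0 k) - const_mx (aff rs xs k)) i 0 @[k --> \oo] --> 0.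
Proof. by move=> zx i; apply: cvg_eq1 (zx i) => k; rewrite !mxE. Qed.

(** The recursion for [s] expresses [kappa2 * y] through differences of [s] and [L x]; the latter
    tends to 0 since [L] annihilates the common affine motion. *)
Lemma tracks_ypart z0 rs xs : kappa2 != 0 -> tracks z0 rs xs ->
  forall i, ypart (z z0 k) i 0 @[k --> \oo] --> 0.
Proof.
move=> k20 zx i; have s0 := tracks_spart zx i.
have Lx := cvg_mulmx0 L (tracks_deviation zx) i.
apply: cvg_eq1 (cvg0_mull kappa2^-1
  (cvg0B (cvg0B s0 (cvg_shift0 s0)) (cvg0_mull kappa1 Lx))) => k.
rewrite clock_state_col spart_col mulmxBr laplacian_const // subr0.
by move: (L *m _) => Lxk; rewrite !mxE; field; rewrite k20 gt_eqF.
Qed.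

Lemma tracks_agree z0 rs xs : tracks z0 rs xs ->
  forall i j, xpart (z z0 k) i 0 - xpart (z z0 k) j 0 @[k --> \oo] --> 0.
Proof.
move=> zx i j; apply: cvg_eq1 (cvg0B (zx i) (zx j)) => k; ring.
Qed.

(** Nodes in [S] measure only nodes of [S], so on [S] the product [L x] agrees with [L] applied to a
    constant vector, which is 0. *)
Lemma closed_set_constant (S : pred 'I_n) (c : R) z0 :
    (forall i j, S i -> E i j -> S j) ->
    (forall i, S i -> [/\ xpart z0 i 0 = c, spart z0 i 0 = 0 &
                          ypart z0 i 0 = 0]) ->
  forall k i, S i -> [/\ xpart (z z0 k) i 0 = c, spart (z z0 k) i 0 = 0 &
                         ypart (z z0 k) i 0 = 0].
Proof.
move=> SE S0; elim=> [|k IH] // i Si.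
rewrite clock_state_col xpart_col spart_col ypart_col.
move: (xpart (z z0 k)) (spart (z z0 k)) (ypart (z z0 k)) IH => x s y IH.
have [xi0 si0 yi0] := IH i Si.
have Lx : (L *m x) i 0 = 0.
  have <- : (L *m (const_mx c : 'cV[R]_n)) i 0 = 0.
    by rewrite laplacian_const // mxE.
  rewrite mxE [RHS]mxE; apply: eq_bigr => j _; rewrite !mxE.
  case: eqVneq => [<-|_]; first by rewrite xi0.
  case: ifP => Eij; last by rewrite !mul0r.
  by have [-> _ _] := IH j (SE _ _ Si Eij).
move: Lx; move: (L *m x) => Lx Lx0; rewrite mul_diag_mx !mxE xi0 si0 yi0 Lx0.
by split; ring.
Qed.

(* The indicator function of the set reachable from [u] stays 1 there and stays
   0 on the disjoint set reachable from [v]. *)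
Lemma sync_connected : clock_sync -> connected_digraph E.
Proof.
move=> sync; apply: contrapT => Ec.
have [u [v uv]] := disconnected_reach (ltnW hn) Ec.
pose z0 : 'cV[R]_(n + (n + n)) :=
  col_mx (\col_i (connect E u i)%:R) (col_mx 0 0).
have [rs [xs zx]] := sync z0.
have closed w i j : connect E w i -> E i j -> connect E w j.
  by move=> wi ij; apply: connect_trans wi (connect1 ij).
have zu : forall i, connect E u i -> [/\ xpart z0 i 0 = 1, spart z0 i 0 = 0 &
    ypart z0 i 0 = 0].
  by move=> i ui; rewrite xpart_col spart_col ypart_col !mxE ui.
have zv : forall i, connect E v i -> [/\ xpart z0 i 0 = 0, spart z0 i 0 = 0 &
    ypart z0 i 0 = 0].
  move=> i vi; rewrite xpart_col spart_col ypart_col !mxE.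
  by case: (boolP (connect E u i)) => // /uv/(_ vi).
suff : 1 = 0 :> R by move/eqP; rewrite oner_eq0.
apply: cvg_cst0; apply: cvg_eq1 (tracks_agree zx u v) => k.
have [-> _ _] := closed_set_constant (closed u) zu k (connect0 E u).
have [-> _ _] := closed_set_constant (closed v) zv k (connect0 E v).
by rewrite subr0.
Qed.

(* If [kappa1 = kappa2] then every [(x, 0, - L x)] is a fixed point. *)
Lemma sync_kappa_neq : clock_sync -> kappa1 <> kappa2.
Proof.
move=> sync kk; pose i0 := Ordinal (ltnW hn); pose i1 := Ordinal hn.
pose x : 'cV[R]_n := \col_i (i == i0)%:R.
pose z0 : 'cV[R]_(n + (n + n)) := col_mx x (col_mx 0 (- (L *m x))).
have Az0 : A *m z0 = z0.
  rewrite clock_mx_col mulmx0 scaler0 addr0 kk scalerN opprK sub0r addNr.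
  by rewrite scalerN scalerBl scale1r opprB addrAC subrr add0r.
have zE k : z z0 k = z0 by elim: k => // k IH; rewrite clock_stateS IH.
have [rs [xs zx]] := sync z0.
suff : 1 = 0 :> R by move/eqP; rewrite oner_eq0.
apply: cvg_cst0; apply: cvg_eq1 (tracks_agree zx i0 i1) => k.
by rewrite zE xpart_col !mxE /= subr0.
Qed.

Lemma tilde_y_iter z0 k :
  tilde_y r xi (z z0 k) = (1 - p) ^+ k * tilde_y r xi z0.
Proof.
elim: k => [|k IH]; first by rewrite expr0 mul1r.
have [_ _ sy] := tilde_step tau kappa1 kappa2 p hr hxiL (z z0 k).
by rewrite clock_stateS sy IH exprS mulrA.
Qed.

(** The average of [y] is geometric with ratio [1 - p]; summing it once gives the average of [s] and
    summing again that of [x]. The parts free of [(1 - p) ^+ k] are the sources of the limit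
    constants. *)
Lemma tilde_closed_form z0 k : p != 0 ->
  tilde_s r xi (z z0 k) = tilde_s r xi z0
    - kappa2 / p * tilde_y r xi z0
    + kappa2 / p * tilde_y r xi z0 * (1 - p) ^+ k /\
  tilde_x r xi (z z0 k) = tilde_x r xi z0
    + tau * (kappa2 / p ^+ 2) * tilde_y r xi z0
    + (tilde_s r xi z0 - kappa2 / p * tilde_y r xi z0) * (k%:R * tau)
    - tau * (kappa2 / p ^+ 2) * tilde_y r xi z0 * (1 - p) ^+ k.
Proof.
move=> p0; elim: k => [|k [IHs IHx]].
  by rewrite expr0; split => /=; field.
have [sx ss _] := tilde_step tau kappa1 kappa2 p hr hxiL (z z0 k).
rewrite clock_stateS sx ss tilde_y_iter IHx IHs exprS -natr1.
by split; field.
Qed.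

End Synchronization.

(** * Spectral consequences of synchronization, and the converse *)

Section Equivalence.
Context (R : realType) (n : nat) (E : rel 'I_n) (alpha : 'I_n -> 'I_n -> R)
  (r : 'I_n -> R) (t0 tau kappa1 kappa2 p : R) (xi : 'cV[R]_n).
Context (hn : (2 <= n)%N) (hE : irreflexive E) (hr : forall i, 0 < r i)
  (htau : 0 < tau)
  (hxiL : xi^T *m laplacian E alpha = 0) (hxi_ge0 : forall i, 0 <= xi i 0)
  (hxi_sum : \sum_i xi i 0 = 1).

Local Notation L := (laplacian E alpha).
Local Notation Rd := (diag_mx (\row_i r i)).
Local Notation A := (clock_mx E alpha r tau kappa1 kappa2 p).
Local Notation z := (clock_state E alpha r tau kappa1 kappa2 p).
Local Notation one := (const_mx 1 : 'cV[R]_n).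
Local Notation rinv := (\col_i (r i)^-1 : 'cV[R]_n).
Local Notation cx := (\row_i (gamma r xi * (xi i 0 / r i)) : 'rV[R]_n).
Local Notation cs := (\row_i (gamma r xi * xi i 0) : 'rV[R]_n).
Local Notation aff rs xs k := (rs * (sample_time t0 tau k - t0) + xs).
Local Notation W := (Wsync r tau kappa2 p).
Local Notation C := (Csync r tau kappa2 p xi).
Local Notation tracks := (tracks E alpha r t0 tau kappa1 kappa2 p).
Local Notation clock_sync := (clock_sync E alpha r t0 tau kappa1 kappa2 p).

(** Splitting off the line of [one] leaves a complement of dimension [n - 1], nonzero as [n >= 2].
    It has a complex eigenvalue, and [Y] pulls its left eigenvector back to one that ignores a
    common clock value. *)
Lemma diag_laplacian_left_eigen :
  exists (mu : R[i]) (eta : 'rV[R[i]]_n),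
    [/\ eta != 0, eta *m complex_mx one = 0 &
        eta *m complex_mx (Rd *m L) = mu *: eta].
Proof.
have CW := cx_one hr hxi_ge0 hxi_sum.
have AW : Rd *m L *m one = one *m (0 : 'M[R]_1).
  by rewrite mulmx0 -mulmxA laplacian_const // mulmx0.
have CA : cx *m (Rd *m L) = (0 : 'M[R]_1) *m cx.
  by rewrite mul0mx mulmxA cx_diag // cs_laplacian.
have [m [B [X [Y [[CX YW YX] [WC AX YA]]]]]] := invariant_splitting CW AW CA.
have [QP PQ] := split_mulmx1 CW CX YW YX WC.
have dE := mulmx1_size QP PQ.
have [mu mu_root] : exists mu, root (char_poly (complex_mx B)) mu.
  by apply/closed_rootP; rewrite size_char_poly; move: hn; lia.
move: mu_root; rewrite -eigenvalue_root_char => /eigenvalueP[v vB v0].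
exists mu, (v *m complex_mx Y); split.
- apply: contra v0 => /eqP vY0; apply/eqP.
  have <- : v *m complex_mx (Y *m X) = v.
    by rewrite YX /complex_mx map_mx1 mulmx1.
  by rewrite complex_mxM mulmxA vY0 mul0mx.
- by rewrite -mulmxA -complex_mxM YW /complex_mx map_mx0 mulmx0.
- by rewrite -mulmxA -complex_mxM YA complex_mxM mulmxA vB scalemxAl.
Qed.

(** The two numbers add up to 2, so they cannot both have modulus below 1. *)
Lemma normc_addB_ge1 (nu : R[i]) : 1 <= normc (1 + nu) \/ 1 <= normc (1 - nu).
Proof.
have := le_normcD (1 + nu) (1 - nu).
have -> : 1 + nu + (1 - nu) = real_complex R 2 by rewrite rmorphD rmorph1; ring.
rewrite normc_real ger0_norm //.
case: (leP 1 (normc (1 + nu))); first by left.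
by right; lra.
Qed.

(* For [kappa2 = 0] the node states obey an undamped double integrator: along
   a left eigenvector of [R L] for [mu] the multipliers are [1 + nu] and
   [1 - nu] with [nu^2 = - tau kappa1 mu], and one of them has modulus at
   least 1. *)
Lemma sync_kappa2_neq0 : clock_sync -> kappa2 != 0.
Proof.
move=> sync; apply/eqP => k20.
have [mu [eta [eta0 eta1 etaRL]]] := diag_laplacian_left_eigen.
have eta1' : eta *m map_mx (real_complex R) one = 0 by [].
have etaRL' : eta *m map_mx (real_complex R) Rd *m map_mx (real_complex R) L
    = mu *: eta by rewrite -mulmxA -map_mxM.
pose T := real_complex R tau; pose K := real_complex R kappa1.
(* The sign of the square root is chosen so that [1 + nu] is the large multiplier. *)
have [nu nu2 nu1] :
    exists2 nu : R[i], nu ^+ 2 = - (T * K * mu) & 1 <= normc (1 + nu).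
  have [h|h] := normc_addB_ge1 (sqrtC (- (T * K * mu))).
    by exists (sqrtC (- (T * K * mu))); rewrite ?sqrtCK.
  by exists (- sqrtC (- (T * K * mu))); rewrite ?sqrrN ?sqrtCK.
pose Xc z0 k := (eta *m complex_mx (xpart (z z0 k))) 0 0.
pose Sc z0 k := (eta *m complex_mx Rd *m complex_mx (spart (z z0 k))) 0 0.
(* This combination diagonalizes the two-dimensional recursion of [Xc] and [Sc]: each step
   multiplies it by [1 + nu]. *)
pose u z0 k := nu * Xc z0 k + T * Sc z0 k.
have XcS z0 k : Xc z0 k.+1 = Xc z0 k + T * Sc z0 k.
  rewrite /Xc /Sc clock_state_col xpart_col /complex_mx map_mxD map_mxZ map_mxM.
  by rewrite mulmxDr -scalemxAr mulmxA !mxE.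
have ScS z0 k : Sc z0 k.+1 = Sc z0 k - K * mu * Xc z0 k.
  rewrite /Xc /Sc clock_state_col spart_col k20 scale0r subr0.
  rewrite /complex_mx map_mxB map_mxZ map_mxM mulmxBr -scalemxAr.
  rewrite !mulmxA etaRL' -scalemxAl scalerA.
  by rewrite !mxE.
have uS z0 k : u z0 k = (1 + nu) ^+ k * u z0 0.
  elim: k => [|k IH]; first by rewrite expr0 mul1r.
  rewrite exprS -mulrA -IH /u XcS ScS.
  have -> : T * (Sc z0 k - K * mu * Xc z0 k) = T * Sc z0 k + nu ^+ 2 * Xc z0 k.
    by rewrite nu2; ring.
  by ring.
(* Synchronization sends [Xc] to 0 because [eta] annihilates constants, and [u] is [Xc] one step
   later minus [(1 - nu) * Xc]. So [u] decays, although its multiplier has modulus at least 1. *)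
have u0 z0 : u z0 0 = 0.
  apply: (le1_powers_decay nu1).
  have [rs [xs zx]] := sync z0.
  have Xc0 : normc (Xc z0 k) @[k --> \oo] --> 0.
    pose d k i := (xpart (z z0 k) - const_mx (aff rs xs k)) i 0.
    apply: (@squeeze0 _ _ (fun k => \sum_i normc (eta 0 i) * `|d k i|)).
      move=> k; rewrite normc_nonneg /=.
      have -> : Xc z0 k = (eta *m complex_mx
          (xpart (z z0 k) - const_mx (aff rs xs k))) 0 0.
        rewrite /complex_mx map_mxB mulmxBr.
        have -> : const_mx (aff rs xs k) = one *m (aff rs xs k)%:M.
          by rewrite mul_mx_scalar; apply/colP => i; rewrite !mxE mulr1.
        by rewrite map_mxM mulmxA eta1' mul0mx subr0.
      rewrite mxE (le_trans (normc_sum _ _ _)) // ler_sum // => i _.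
      by rewrite ComplexField.Normc.normcM [complex_mx _ _ _]mxE normc_real.
    apply: cvg_sum0 => i _; apply: cvg0_mull.
    by apply/norm_cvg0P; exact: tracks_deviation zx i.
  apply: (@squeeze0 _ _ (fun k => normc (Xc z0 k.+1)
                                  + normc (1 - nu) * normc (Xc z0 k))).
    move=> k; rewrite normc_nonneg /= -uS.
    have -> : u z0 k = Xc z0 k.+1 + - ((1 - nu) * Xc z0 k).
      by rewrite XcS /u; ring.
    rewrite (le_trans (le_normcD _ _)) // lerD2l normcN.
    by rewrite ComplexField.Normc.normcM.
  exact: cvgD0 (cvg_shift0 Xc0) (cvg0_mull (normc (1 - nu)) Xc0).
(* Starting with [s] the [i]-th unit vector and [x = y = 0], the initial value of [u] is
   [tau * eta 0 i * r i], so [eta] would be 0. *)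
move/eqP: eta0; apply; apply/rowP => i.
have := u0 (col_mx 0 (col_mx (delta_mx i 0) 0)).
rewrite /u /Xc /Sc xpart_col spart_col /complex_mx map_mx0 mulmx0 mxE mulr0.
rewrite add0r.
rewrite map_delta_mx -colE map_diag_mx mul_mx_diag !mxE => /eqP.
rewrite mulf_eq0 [T == 0]fmorph_eq0 gt_eqF //= mulf_eq0 fmorph_eq0.
by rewrite (gt_eqF (hr i)) orbF => /eqP.
Qed.

(** From the initial state [(0, 0, 1 / r)] the average of [y] is exactly [(1 - p) ^+ k]. *)
Lemma ypart_decay_p :
    (forall z0 i, ypart (z z0 k) i 0 @[k --> \oo] --> 0) -> 0 < p < 2.
Proof.
move=> y0; suff : `|1 - p| < 1 by rewrite ltr_norml => /andP[]; lra.
apply: decay_ratio.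
apply: cvg_eq1 (cvg_mulmx0 cs (y0 (col_mx 0 (col_mx 0 rinv))) 0) => k.
rewrite -tilde_yE tilde_y_iter // tilde_yE ypart_col cs_rinv // mxE.
by rewrite mulr1.
Qed.

(** The span of [W] has dimension 3, and comparing sizes gives its complement the order required of
    [J2]. *)
Lemma clock_splitting : p != 0 ->
  exists (B : 'M[R]_(3 * n - 3)) X Y,
    [/\ C *m X = 0, Y *m W = 0 & Y *m X = 1%:M] /\
    [/\ W *m C + X *m Y = 1%:M, A *m X = X *m B & Y *m A = B *m Y].
Proof.
move=> p0.
have CW := Csync_Wsync kappa2 p hr htau hxi_ge0 hxi_sum.
have AW := clock_Wsync alpha tau kappa1 kappa2 hE hr p0.
have CA := Csync_clock kappa1 kappa2 hr htau hxiL p0.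
have [m [B [X [Y [[CX YW YX] [WC AX YA]]]]]] := invariant_splitting CW AW CA.
have [QP PQ] := split_mulmx1 CW CX YW YX WC.
have dE := mulmx1_size QP PQ.
have mE : m = (3 * n - 3)%N by move: dE; lia.
by subst m; exists B, X, Y.
Qed.

Lemma splitting_iter m (B : 'M[R]_m) (Y : 'M[R]_(m, n + (n + n))) z0 k :
  Y *m A = B *m Y -> Y *m z z0 k = B ^+ k *m (Y *m z0).
Proof.
move=> YA; elim: k => [|k IH]; first by rewrite expr0 mul1mx.
by rewrite clock_stateS mulmxA YA -mulmxA IH exprS -mulmxA.
Qed.

Lemma col_mx_cvg0 (x s y : nat -> 'cV[R]_n) :
  (forall i, x k i 0 @[k --> \oo] --> 0) ->
  (forall i, s k i 0 @[k --> \oo] --> 0) ->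
  (forall i, y k i 0 @[k --> \oo] --> 0) ->
  forall i, col_mx (x k) (col_mx (s k) (y k)) i 0 @[k --> \oo] --> 0.
Proof.
move=> x0 s0 y0 i; case: (split_ordP i) => j ->.
  by apply: cvg_eq1 (x0 j) => k; rewrite col_mxEu.
case: (split_ordP j) => l ->.
  by apply: cvg_eq1 (s0 l) => k; rewrite col_mxEd col_mxEu.
by apply: cvg_eq1 (y0 l) => k; rewrite !col_mxEd.
Qed.

(* Modulo the columns of [Wsync], [z_k] differs from 0 only by its deviation
   from the affine motion [(aff, rs / r, 0)]. *)
Lemma tracks_complement_decay m (Y : 'M[R]_(m, n + (n + n))) z0 rs xs :
    kappa2 != 0 -> Y *m W = 0 -> tracks z0 rs xs ->
  forall i, (Y *m z z0 k) i 0 @[k --> \oo] --> 0.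
Proof.
move=> k20 YW zx.
pose dev k := col_mx (xpart (z z0 k) - const_mx (aff rs xs k))
  (col_mx (spart (z z0 k) - rs *: rinv) (ypart (z z0 k))).
have Yz k : Y *m z z0 k = Y *m dev k.
  have -> : dev k =
      z z0 k - W *m col_mx (aff rs xs k / tau)%:M (col_mx rs%:M 0).
    rewrite {1}[z z0 k in RHS]state_eta /Wsync !mul_row_col mulmx0 addr0.
    rewrite !mul_mx_scalar !scale_col_mx !scaler0 add_col_mx addr0.
    rewrite add_col_mx add0r addr0 !opp_col_mx !add_col_mx subr0.
    congr (col_mx (_ - _) _); apply/colP => i; rewrite !mxE mulr1 divfK //.
    by rewrite gt_eqF.
  by rewrite mulmxBr mulmxA YW mul0mx subr0.
move=> i; under eq_cvg do rewrite Yz; apply: cvg_mulmx0 => {}i.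
apply: col_mx_cvg0 => {}i.
- exact: tracks_deviation zx i.
- by apply: cvg_eq1 (tracks_spart hr htau zx i) => k; rewrite [RHS]mxE !mxE.
- exact: tracks_ypart zx i.
Qed.

Lemma complex_clock_similar (B : 'M[R]_(3 * n - 3)) X Y :
    p != 0 ->
    [/\ C *m X = 0, Y *m W = 0 & Y *m X = 1%:M] ->
    [/\ W *m C + X *m Y = 1%:M, A *m X = X *m B & Y *m A = B *m Y] ->
  exists (Q : 'M[R[i]]_(n + (n + n), 3 + (3 * n - 3)))
         (P : 'M[R[i]]_(3 + (3 * n - 3), n + (n + n))),
    [/\ Q *m P = 1%:M, P *m Q = 1%:M &
        complex_mx A =
        Q *m block_mx (complex_mx (Jhat1 p)) 0 0 (complex_mx B) *m P].
Proof.
move=> p0 [CX YW YX] [WC AX YA].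
have CW := Csync_Wsync kappa2 p hr htau hxi_ge0 hxi_sum.
have AW := clock_Wsync alpha tau kappa1 kappa2 hE hr p0.
have [QP PQ] := split_mulmx1 CW CX YW YX WC.
have AQ := split_similar WC AW AX.
exists (complex_mx (row_mx W X)), (complex_mx (col_mx C Y)).
rewrite -!complex_mxM QP PQ AQ /complex_mx !map_mx1; split => //.
by rewrite !map_mxM map_block_mx !map_mx0.
Qed.

(** Cancelling the factor of [Jhat1 p] shows that [B] and [J2] have the same characteristic
    polynomial, so [B ^+ k] tends to 0; the deviation is [X B^k Y z0]. *)
Lemma stable_delta_decay (J2 : 'M[R[i]]_(3 * n - 3)) z0 :
    p != 0 -> is_Jhat2 A p J2 -> spectral_radius J2 < 1 ->
  forall i, col_mx (delta_x r xi (z z0 k))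
    (col_mx (delta_s r xi (z z0 k)) (delta_y r xi (z z0 k))) i 0
    @[k --> \oo] --> 0.
Proof.
move=> p0 [jJ [Q [P [QP PQ AE]]]] /spectral_radius_lt1 J21 i.
have [B [X [Y [ortho inter]]]] := clock_splitting p0.
have [Q' [P' [QP' PQ' AE']]] := complex_clock_similar p0 ortho inter.
have BJ : char_poly (complex_mx B) = char_poly J2.
  have := char_poly_similar QP PQ AE.
  rewrite (char_poly_similar QP' PQ' AE') !char_poly_block_diag.
  by apply: mulfI; rewrite monic_neq0 // char_poly_monic.
have B0 : forall i j, (B ^+ k) i j @[k --> \oo] --> 0.
  by apply: complex_mx_powers_decay; rewrite BJ.
case: inter => WC AX YA.
pose v k := B ^+ k *m (Y *m z0).
apply: (@cvg_eq1 _ _ (fun k => (X *m v k) i 0)) => [k|].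
  rewrite /v -(splitting_iter _ _ YA) mulmxA.
  have -> : X *m Y = 1%:M - W *m C by rewrite -WC addrC addKr.
  rewrite mulmxBl mul1mx -mulmxA Wsync_Csync //.
  by rewrite opprB addrC subrK.
apply: cvg_mulmx0 => {}i; rewrite /v; under eq_cvg do rewrite mxE.
apply: cvg_sum0 => j _.
apply: cvg_eq1 (cvg0_mull ((Y *m z0) j 0) (B0 i j)) => k.
exact: mulrC.
Qed.

(** First [kappa2 != 0] makes [y] decay, which gives [0 < p < 2] and thereby the splitting. A Jordan
    form of [B] then serves as [J2]. *)
Lemma sync_stable : clock_sync ->
  [/\ connected_digraph E, kappa1 <> kappa2, 0 < p < 2 &
      exists2 J2 : 'M[R[i]]_(3 * n - 3),
        is_Jhat2 A p J2 & spectral_radius J2 < 1].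
Proof.
move=> sync; have k20 := sync_kappa2_neq0 sync.
have p02 : 0 < p < 2.
  apply: ypart_decay_p => z0 i; have [rs [xs zx]] := sync z0.
  exact: tracks_ypart zx i.
have p0 : p != 0 by rewrite gt_eqF //; case/andP: p02.
split=> //; first exact: sync_connected sync.
  exact: sync_kappa_neq sync.
have [B [X [Y [ortho inter]]]] := clock_splitting p0.
have [Q' [P' [QP' PQ' AE']]] := complex_clock_similar p0 ortho inter.
have [k [J BJ]] := jordan_form_exists (complex_mx B).
have [jJ [Q [P [QP PQ BE]]]] := BJ.
have kE := mulmx1_size QP PQ; subst k.
exists J; first exact: jordan_form_split QP' PQ' AE' (Jhat1_is_jordan p) BJ.
apply/spectral_radius_lt1 => l; rewrite -(char_poly_similar QP PQ BE).
rewrite -eigenvalue_root_char; apply: complex_mx_decay_eigenvalue => i j.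
have [_ YW YX] := ortho; have [_ _ YA] := inter.
(* From this initial state, [Y z_k] is column [j] of [B ^+ k]. *)
have [rs [xs zx]] := sync (X *m delta_mx j 0).
apply: cvg_eq1 (tracks_complement_decay k20 YW zx i) => k.
by rewrite (splitting_iter _ _ YA) (mulmxA Y) YX mul1mx -colE mxE.
Qed.

Lemma tilde_x_affine z0 k : p != 0 ->
  tilde_x r xi (z z0 k) -
  aff (tilde_s r xi z0 - kappa2 / p * tilde_y r xi z0)
      (tilde_x r xi z0 + tau * (kappa2 / p ^+ 2) * tilde_y r xi z0) k =
  - (tau * (kappa2 / p ^+ 2) * tilde_y r xi z0) * (1 - p) ^+ k.
Proof.
move=> p0; have [_ ->] := tilde_closed_form tau kappa1 kappa2 hr hxiL z0 k p0.
by rewrite sample_timeB; ring.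
Qed.

Lemma ratio_decay : 0 < p < 2 -> (1 - p) ^+ k @[k --> \oo] --> 0.
Proof. by move=> /andP[p0 p2]; apply: cvg_expr; rewrite ltr_norml; lra. Qed.

(** As [cx] has total weight 1, the average of [x] follows the same affine motion as the nodes.
    Comparison with the closed form leaves a vanishing affine function of [k], so the coefficients
    agree. *)
Lemma tracks_limit z0 rs xs : 0 < p < 2 -> tracks z0 rs xs ->
  rs = tilde_s r xi z0 - kappa2 / p * tilde_y r xi z0 /\
  xs = tilde_x r xi z0 + tau * (kappa2 / p ^+ 2) * tilde_y r xi z0.
Proof.
move=> p02 zx; have p0 : p != 0 by rewrite gt_eqF //; case/andP: p02.
have x0 : tilde_x r xi (z z0 k) - aff rs xs k @[k --> \oo] --> 0.
  apply: cvg_eq1 (cvg_mulmx0 cx (tracks_deviation zx) 0) => k.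
  rewrite mulmxBr [LHS]mxE -tilde_xE [X in _ + X]mxE; congr (_ - _).
  have -> : const_mx (aff rs xs k) = aff rs xs k *: one.
    by apply/colP => i; rewrite !mxE mulr1.
  by rewrite -scalemxAr cx_one // !mxE mulr1.
have := cvg0B (cvg0_mull (- (tau * (kappa2 / p ^+ 2) * tilde_y r xi z0))
  (ratio_decay p02)) x0.
set rs' := _ - kappa2 / p * _; set xs' := _ + _ * tilde_y r xi z0 => x0'.
have : (rs - rs') * tau * k%:R + (xs - xs') @[k --> \oo] --> 0.
  apply: cvg_eq1 x0' => k.
  by rewrite -tilde_x_affine // -/rs' -/xs' sample_timeB; ring.
move=> /cvg_affine0[/eqP]; rewrite mulf_eq0 (gt_eqF htau) orbF.
by rewrite subr_eq0 => /eqP -> /eqP; rewrite subr_eq0 => /eqP ->.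
Qed.

End Equivalence.

Unset Implicit Arguments.

Theorem theorem1 (R : realType) (n : nat) (hn : (2 <= n)%N)
    (E : rel 'I_n) (hE : irreflexive E)
    (alpha : 'I_n -> 'I_n -> R) (halpha : forall i j, E i j -> 0 < alpha i j)
    (r : 'I_n -> R) (hr : forall i, 0 < r i)
    (t0 tau : R) (htau : 0 < tau) (kappa1 kappa2 p : R)
    (xi : 'cV[R]_n) (hxiL : xi^T *m laplacian E alpha = 0)
    (hxi_ge0 : forall i, 0 <= xi i 0) (hxi_sum : \sum_i xi i 0 = 1) :
  let A := clock_mx E alpha r tau kappa1 kappa2 p in
  let z := clock_state E alpha r tau kappa1 kappa2 p in
  let t := sample_time t0 tau in
  let stable :=
    [/\ connected_digraph E, kappa1 <> kappa2, 0 < p < 2 &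
        exists2 J2 : 'M[R[i]]_(3 * n - 3),
          is_Jhat2 A p J2 & spectral_radius J2 < 1] in
  let decoupled :=
    forall z0 : 'cV[R]_(n + (n + n)), exists rstar xstar : R,
      [/\ (delta_x r xi (z z0 k) @[k --> \oo] --> (0 : 'cV[R]_n)),
          (delta_s r xi (z z0 k) @[k --> \oo] --> (0 : 'cV[R]_n)) &
          (delta_y r xi (z z0 k) @[k --> \oo] --> (0 : 'cV[R]_n))] /\
      [/\ (tilde_x r xi (z z0 k) - (rstar * (t k - t0) + xstar)
             @[k --> \oo] --> (0 : R)),
          (tilde_s r xi (z z0 k) @[k --> \oo] --> rstar) &
          (tilde_y r xi (z z0 k) @[k --> \oo] --> (0 : R))] in
  let follows (z0 : 'cV[R]_(n + (n + n))) (rstar xstar : R) :=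
    forall i : 'I_n,
      xpart (z z0 k) i 0 - (rstar * (t k - t0) + xstar)
        @[k --> \oo] --> (0 : R) in
  let synchronizes :=
    forall z0 : 'cV[R]_(n + (n + n)), exists rstar xstar : R,
      follows z0 rstar xstar in
  [<-> stable; decoupled; synchronizes] /\
  (synchronizes ->
   forall (z0 : 'cV[R]_(n + (n + n))) (rstar xstar : R),
     follows z0 rstar xstar ->
     xstar = gamma r xi * \sum_i xi i 0 *
               (1 / r i * xpart z0 i 0 + tau * (kappa2 / p ^+ 2) * ypart z0 i 0)
     /\ rstar = gamma r xi * \sum_i xi i 0 *
               (spart z0 i 0 - kappa2 / p * ypart z0 i 0)).
Proof.
split; first tfae.
- move=> [_ _ p02 [J2 AJ2 J21]] z0.
  have p0 : p != 0 by rewrite gt_eqF //; case/andP: p02.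
  have D := stable_delta_decay hn hE hr htau hxiL hxi_ge0 hxi_sum z0 p0 AJ2 J21.
  exists (tilde_s r xi z0 - kappa2 / p * tilde_y r xi z0),
    (tilde_x r xi z0 + tau * (kappa2 / p ^+ 2) * tilde_y r xi z0).
  have q0 := ratio_decay p02.
  split; split.
  + apply/cvg_col0P => i; apply: cvg_eq1 (D (lshift (n + n) i)) => k.
    by rewrite col_mxEu.
  + apply/cvg_col0P => i; apply: cvg_eq1 (D (rshift n (lshift n i))) => k.
    by rewrite col_mxEd col_mxEu.
  + apply/cvg_col0P => i; apply: cvg_eq1 (D (rshift n (rshift n i))) => k.
    by rewrite !col_mxEd.
  + apply: cvg_eq1 (cvg0_mull _ q0) => k; symmetry; exact: tilde_x_affine.
  + set c := kappa2 / p * tilde_y r xi z0.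
    apply: cvg_eq1 (cvgD0 (cvg_cst (tilde_s r xi z0 - c))
      (cvg0_mull c q0)) => k.
    by have [-> _] := tilde_closed_form tau kappa1 kappa2 hr hxiL z0 k p0.
  + apply: cvg_eq1 (cvg0_mull (tilde_y r xi z0) q0) => k.
    by rewrite mulrC tilde_y_iter.
- move=> dec z0; have [rs [xs [[dx _ _] [tx _ _]]]] := dec z0.
  exists rs, xs => i.
  (* The error of node [i] is its deviation plus the error of the average. *)
  apply: cvg_eq1 (cvgD0 ((cvg_col0P _).1 dx i) tx) => k.
  by rewrite [delta_x _ _ _ _ _]mxE addrA subrK.
- exact: (sync_stable (t0 := t0) hn hE hr htau hxiL hxi_ge0 hxi_sum).
move=> sync z0 rs xs zx.
(* Synchronization itself supplies the range of [p] on which the limit constants are determined. *)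
have [_ _ p02 _] :=
  sync_stable (t0 := t0) hn hE hr htau hxiL hxi_ge0 hxi_sum sync.
have [-> ->] := tracks_limit (t0 := t0) hr htau hxiL hxi_ge0 hxi_sum p02 zx.
split.
- rewrite /tilde_x /tilde_y mulrCA -mulrDr; congr (_ * _).
  rewrite mulr_sumr -big_split; apply: eq_bigr => i _ /=.
  by rewrite mulrDr !mulrA; ring.
- rewrite /tilde_s /tilde_y mulrCA -mulrBr; congr (_ * _).
  rewrite mulr_sumr -sumrB; apply: eq_bigr => i _ /=.
  by rewrite mulrBr !mulrA; ring.
Qed.
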